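(* Let $G=(V,E)$ be a graph and let $\Theta(G)=P(G)\cap 2M(G)\subset\mathbb{R}^E$. The integer points of $\Theta(G)$ are exactly the indicator vectors of Hamiltonian paths in $G$, i.e. $\Theta(G)\cap\mathbb{Z}^E=\{e_T\mid T\subseteq E\text{ is a Hamiltonian path of }G\}$.
   Context: All graphs $G=(V,E)$ are finite, simple (no multi-edges), loopless and connected. A spanning tree of $G$ is a maximal acyclic subset of edges $T\subseteq E$. A Hamiltonian path is a spanning tree which is also a path. A matching is a (possibly empty) subset of edges $M\subseteq E$ which covers every vertex at most once. For $A\subseteq E$ the indicator vector is $e_A=\sum_{i\in A}e_i\in\mathbb{R}^E$, with $(e_i)_{i\in E}$ the standard basis. The spanning tree polytope is $P(G)=\operatorname{conv}(e_T\mid T\text{ is a spanning tree})$, the matching polytope is $M(G)=\operatorname{conv}(e_M\mid M\text{ is a matching})$, and $2M(G)=\{2x\mid x\in M(G)\}$. *)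

(* Defs.v *)
From mathcomp Require Import all_boot all_order all_algebra.
From mathcomp Require Import boolp classical_sets reals convex.

Set Implicit Arguments.
Unset Strict Implicit.
Unset Printing Implicit Defensive.

Import Order.TTheory GRing.Theory Num.Theory.

Local Open Scope classical_set_scope.
Local Open Scope ring_scope.
Local Open Scope set_scope.

Record sgraph := SGraph {
  vertex : finType;
  edges : {set {set vertex}};
  edges_card2 : forall A, A \in edges -> #|A| = 2%N }.

Definition edge (G : sgraph) : finType := {A : {set vertex G} | A \in edges G}.

Definition ends (G : sgraph) (i : edge G) : {set vertex G} := val i.

Definition adj (G : sgraph) : rel (vertex G) :=
  fun x y => [set x; y] \in edges G.

(* The graph with no vertices does not count as connected. *)
Definition connected_graph (G : sgraph) : Prop :=
  (0 < #|vertex G|)%N /\ forall x y : vertex G, connect (@adj G) x y.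

Section EdgeSets.
Variable G : sgraph.
Implicit Types S T M : {set edge G}.

Definition edge_rel T : rel (vertex G) := fun x y => [set x; y] \in @ends G @: T.

(* A closed walk without repeated vertices is a cycle of the graph only if it
   has at least three vertices: an edge traversed back and forth is not one. *)
Definition acyclic T : Prop :=
  forall c : seq (vertex G), ucycle (edge_rel T) c -> (size c < 3)%N.

Definition spanning_tree T : Prop :=
  acyclic T /\ forall S, acyclic S -> T \subset S -> S = T.

(* T consists of the edges {v_0, v_1}, ..., {v_(n-1), v_n} for some pairwise
   distinct vertices v_0, ..., v_n; n = 0, i.e. T empty, is allowed. *)
Definition is_path T : Prop :=
  exists (x : vertex G) (p : seq (vertex G)),
    uniq (x :: p) /\
    @ends G @: T = [set A in pairmap (fun u v : vertex G => [set u; v]) x p].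

Definition hamiltonian_path T : Prop := spanning_tree T /\ is_path T.

Definition matching M : Prop :=
  forall v : vertex G, (#|[set i in M | v \in ends i]| <= 1)%N.

End EdgeSets.

Local Close Scope set_scope.

Definition conv (R : realType) (V : lmodType R) (A : set V) : set V :=
  smallest (@convex_set R V) A.

(* R^o, convertible to R, is what makes {ffun edge G -> R^o} the vector space
   R^E; plain {ffun edge G -> R} has no lmodType structure. *)
Section Polytopes.
Variables (R : realType) (G : sgraph).

Definition std_basis (i : edge G) : {ffun edge G -> R^o} :=
  [ffun j => (j == i)%:R].

Definition indicator (A : {set edge G}) : {ffun edge G -> R^o} :=
  \sum_(i in A) std_basis i.

Definition spanning_tree_polytope : set {ffun edge G -> R^o} :=
  conv [set indicator T | T in [set T | spanning_tree T]].

Definition matching_polytope : set {ffun edge G -> R^o} :=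
  conv [set indicator M | M in [set M | matching M]].

Definition Theta : set {ffun edge G -> R^o} :=
  spanning_tree_polytope `&` [set 2 *: x | x in matching_polytope].

Definition integer_points : set {ffun edge G -> R^o} :=
  [set x : {ffun edge G -> R^o} | forall i : edge G, (x i : R) \is a Num.int].

End Polytopes.

Arguments indicator R {G} A.
Arguments spanning_tree_polytope R G : clear implicits.
Arguments matching_polytope R G : clear implicits.
Arguments Theta R G : clear implicits.
Arguments integer_points R G : clear implicits.

(* Main.v *)
(* An integral point of P(G) is a 0/1 vector, hence an extreme point of the cube
   [0,1]^E, so it must be one of the generators e_T of P(G).  The functionals
   sum_(i contains v) x_i are at most 2 on 2M(G), so every vertex has degree at
   most 2 in T, and a spanning tree of maximum degree 2 is a path.  Conversely,
   the edges of a path split alternately into two matchings M and M', and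
   e_T = 2 (e_M / 2 + e_M' / 2). *)

Require Import Defs.
From mathcomp Require Import all_boot all_order all_algebra.
From mathcomp Require Import boolp classical_sets reals convex.
From mathcomp Require Import interval_inference zify lra.

Set Implicit Arguments.
Unset Strict Implicit.
Unset Printing Implicit Defensive.

Import Order.TTheory GRing.Theory Num.Theory.

(** * Edge sets of a graph: cycles, degree bounds and paths *)

Section Combinatorics.
Local Open Scope set_scope.
Local Open Scope nat_scope.
Variable G : sgraph.
Implicit Types (T M : {set edge G}) (x y z v a b : vertex G) (i : edge G).

Lemma card_ends i : #|ends i| = 2.
Proof. exact: (edges_card2 (valP i)). Qed.

Lemma edge_rel_sym T : symmetric (edge_rel T).
Proof. by move=> x y; rewrite /edge_rel finset.setUC. Qed.

Lemma edge_rel_neq T x y : edge_rel T x y -> x != y.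
Proof.
by case/imsetP=> i _ Ei; move: (card_ends i); rewrite -Ei cards2; case: eqP.
Qed.

Lemma edge_relU1 T i x y :
  edge_rel (i |: T) x y = (ends i == [set x; y]) || edge_rel T x y.
Proof. by rewrite /edge_rel imsetU1 in_setU1 eq_sym. Qed.

Lemma path_invariant (e : rel (vertex G)) (W : pred (vertex G)) x p :
  (forall u w, e u w -> W u = W w) -> path e x p -> W x = W (last x p).
Proof. by move=> We; elim: p x => //= y p IHp x /andP[/We -> /IHp]. Qed.

(* A cycle through the new edge ab would return from b to a inside T, along
   which W is constant. *)
Lemma bridge_acyclic (W : pred (vertex G)) T i a b :
    (forall u w, edge_rel T u w -> W u = W w) -> W a != W b ->
    ends i = [set a; b] -> acyclic T -> acyclic (i |: T).
Proof.
move=> We Wab Ei acT c /andP[cyc Uc].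
have [//|c3] := boolP (size c < 3); exfalso; move: c3; rewrite -leqNgt => c3.
(* The only new edge contains [a], so steps avoiding [a] already belong to [T]. *)
have off : {in predC1 a &, subrel (edge_rel (i |: T)) (edge_rel T)}.
  move=> u w; rewrite !inE => ua wa.
  rewrite edge_relU1 Ei => /orP[/eqP /setP /(_ a)|//].
  by rewrite !inE eqxx [a == u]eq_sym (negPf ua) [a == w]eq_sym (negPf wa).
have at_a w : w != b -> edge_rel (i |: T) a w -> edge_rel T a w.
  move=> wb; rewrite edge_relU1 Ei => /orP[/eqP /setP /(_ b)|//].
  rewrite !inE eqxx orbT [b == w]eq_sym (negPf wb) orbF => /esym/eqP Eba.
  by rewrite Eba eqxx in Wab.
have [ac|ac] := boolP (a \in c); last first.
  suff : size c < 3 by rewrite ltnNge c3.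
  apply: acT; rewrite /ucycle Uc andbT; apply: (sub_in_cycle off) cyc.
  by apply/allP => u uc; apply: contraNneq ac => <-.
have [k c' Ec] := rot_to ac.
rewrite -(rot_cycle k) Ec in cyc; rewrite -(rot_uniq k) Ec in Uc.
rewrite -(size_rot k) Ec in c3; case: c' => [|y [|z q]] // in Ec cyc Uc c3 *.
(* The cycle has at least three vertices, so the two cycle neighbours of [a] differ and at most one
   of them is [b]. *)
have yl : y != last y (z :: q).
  by apply: contraTneq Uc => /= E; rewrite {2}E mem_last !andbF.
have la : edge_rel (i |: T) a (last y (z :: q)).
  by move: cyc; rewrite (cycle_path a) edge_rel_sym => /= /andP[].
have [ay yp] : edge_rel (i |: T) a y /\ path (edge_rel T) y (z :: q).
  move: cyc; rewrite (cycle_path a) => /= /and3P[_ ay yp].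
  split=> //; apply: (@sub_in_path _ _ _ _ off y (z :: q)) yp.
  by apply/allP => u uy; apply: contraTneq Uc => Eu; rewrite cons_uniq -Eu uy.
have Wyl := path_invariant We yp.
(* If one neighbour is [b], the rest of the cycle leads from [b] back to [a] inside [T], forcing
   [W a = W b]. If neither is, the whole cycle lies in [T]. *)
have [Eb|yb] := eqVneq y b.
  have lb : last y (z :: q) != b by rewrite -Eb eq_sym.
  by rewrite (We _ _ (at_a _ lb la)) -Wyl Eb eqxx in Wab.
have Way := We _ _ (at_a _ yb ay).
have [El|lb] := eqVneq (last y (z :: q)) b.
  by rewrite Way Wyl El eqxx in Wab.
suff: size [:: a, y, z & q] < 3 by [].
apply: acT; rewrite /ucycle Uc andbT (cycle_path a).
by rewrite [path _ _ _]/= edge_rel_sym (at_a _ lb la) (at_a _ yb ay).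
Qed.

(** A third neighbour would put three distinct edges of [T] at [v]. *)
Lemma degree2_neighbours T v x y z :
    #|[set i in T | v \in ends i]| <= 2 -> edge_rel T v x -> edge_rel T v y ->
    x != y -> edge_rel T v z -> z \in [:: x; y].
Proof.
move=> deg vx vy xy vz; rewrite !inE; apply: contraLR deg => /norP[zx zy].
case/imsetP: (vx) => i iT Ei; case/imsetP: (vy) => j jT Ej.
case/imsetP: (vz) => k kT Ek; rewrite -ltnNge.
have inj u w i1 i2 : edge_rel T v u -> [set v; u] = ends i1 ->
    [set v; w] = ends i2 -> u != w -> i1 != i2.
  move=> vu E1 E2; apply: contraNneq => E; move: E1; rewrite E -E2.
  move/setP/(_ u); rewrite !inE eqxx orbT [u == v]eq_sym.
  by rewrite (negPf (edge_rel_neq vu)).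
have U : uniq [:: i; j; k].
  have yz : y != z by rewrite eq_sym.
  have xz : x != z by rewrite eq_sym.
  rewrite /= !inE negb_or (inj _ _ _ _ vx Ei Ej xy).
  by rewrite (inj _ _ _ _ vx Ei Ek xz) (inj _ _ _ _ vy Ej Ek yz).
rewrite cardE; apply: (uniq_leq_size U) => l; rewrite mem_enum !inE.
by case/or3P => /eqP ->; rewrite ?iT ?jT ?kT -?Ei -?Ej -?Ek !inE eqxx.
Qed.

Local Notation pair_set := (fun u v : vertex G => [set u; v]).

Lemma mem_pairmapP x p (A : {set vertex G}) :
  reflect (exists2 k, k < size p & A = [set nth x (x :: p) k; nth x p k])
          (A \in pairmap pair_set x p).
Proof.
apply: (iffP (nthP finset.set0)); rewrite size_pairmap => -[k kp].
  by rewrite (nth_pairmap x) // => <-; exists k.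
by move=> ->; exists k; rewrite ?(nth_pairmap x).
Qed.

(** The two path edges at an inner vertex exhaust its degree. At an end, every neighbour is on the
    path; an edge joining both ends closes a cycle unless the path is a single edge. *)
Lemma maximal_path_edges T x p :
    acyclic T -> (forall v, #|[set i in T | v \in ends i]| <= 2) ->
    uniq (x :: p) -> path (edge_rel T) x p ->
    (forall z, edge_rel T x z -> z \in x :: p) ->
    (forall z, edge_rel T (last x p) z -> z \in x :: p) ->
  forall v z, v \in x :: p -> edge_rel T v z ->
    [set v; z] \in pairmap pair_set x p.
Proof.
move=> acT deg U pT maxx maxl; set s := x :: p; set n := size p.
have step k : k < n -> edge_rel T (nth x s k) (nth x s k.+1).
  exact: (pathP x pT).
have pairk k : k < n -> [set nth x s k; nth x s k.+1] \in pairmap pair_set x p.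
  by move=> kn; apply/mem_pairmapP; exists k.
have inner k z : 0 < k < n -> edge_rel T (nth x s k) z ->
    [set nth x s k; z] \in pairmap pair_set x p.
  case: k => // k /= kn kz; have ltkn := ltnW kn.
  (* The inner vertex is now at position [k.+1], with path neighbours at [k] and [k.+2]. *)
  have := degree2_neighbours (deg _) _ (step _ kn) _ kz.
  move/(_ (nth x s k)); rewrite edge_rel_sym step //.
  rewrite nth_uniq ?[size s]/= ?ltnS ?(ltnW ltkn) //.
  rewrite ltn_eqF // => /(_ isT isT); rewrite !inE.
  case/orP => /eqP ->; last exact: (pairk k.+1).
  by rewrite finset.setUC; apply: (pairk k).
move=> _ z /(nthP x)[k kn <-] kz.
have {}kn : k <= n := kn.
have [kin|kout] := boolP (0 < k < n); first exact: inner.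
have: z \in s.
  have [Ek|Ek] : k = 0 \/ k = n by lia.
    by apply: maxx; rewrite Ek in kz.
  by apply: maxl; rewrite (last_nth x) -/n -Ek.
case/(nthP x)=> l ln El; have {}ln : l <= n := ln; rewrite -El in kz *.
have [lin|lout] := boolP (0 < l < n).
  by rewrite finset.setUC inner // edge_rel_sym.
have kl : k != l by apply: contraTneq (edge_rel_neq kz) => ->; rewrite eqxx.
have n_gt0 : 0 < n by lia.
have closing : edge_rel T (nth x s n) (nth x s 0).
  have [[Ek Ej]|[Ek Ej]] : (k = n /\ l = 0) \/ (k = 0 /\ l = n) by lia.
    by rewrite Ek Ej in kz.
  by rewrite edge_rel_sym; rewrite Ek Ej in kz.
have: size (x :: p) < 3.
  apply: acT; rewrite /ucycle U andbT (cycle_path x) /= pT andbT.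
  by rewrite (last_nth x).
rewrite /= -/n => n2; have En : n = 1 by lia.
have [[Ek Ej]|[Ek Ej]] : (k = 1 /\ l = 0) \/ (k = 0 /\ l = 1) by lia.
  by rewrite Ek Ej finset.setUC; apply: pairk; rewrite En.
by rewrite Ek Ej; apply: pairk; rewrite En.
Qed.

(** Take a path with the most edges; a neighbour of an end lying off the path would extend it. *)
Lemma exists_maximal_path T x0 :
  exists x p, [/\ uniq (x :: p), path (edge_rel T) x p,
    forall z, edge_rel T x z -> z \in x :: p
    & forall z, edge_rel T (last x p) z -> z \in x :: p].
Proof.
pose P n := `[< exists x p,
  [/\ uniq (x :: p), path (edge_rel T) x p & size p = n] >].
have P0 : exists n, P n by exists 0; apply/asboolP; exists x0, [::].
have Pmax n : P n -> n <= #|vertex G|.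
  case/asboolP => x [p [U _ <-]].
  by apply: ltnW; rewrite -[X in X <= _]/(size (x :: p)) -(card_uniqP U) max_card.
have [n /asboolP[x [p [U pT sp]]] nmax] := ex_maxnP P0 Pmax.
exists x, p; split=> // z xz; apply/negPn/negP => zp.
  suff /nmax : P n.+1 by rewrite ltnn.
  apply/asboolP; exists z, (x :: p); split; last by rewrite /= sp.
    by rewrite cons_uniq zp.
  by rewrite /= edge_rel_sym xz.
suff /nmax : P n.+1 by rewrite ltnn.
apply/asboolP; exists x, (rcons p z); split; last by rewrite size_rcons sp.
  by rewrite -rcons_cons rcons_uniq zp.
by rewrite rcons_path pT.
Qed.

(** Edges of [T] meeting a maximal path are path edges, so its vertex set is closed under [T].
    Connectedness of [G] and maximality of [T] then make it contain every vertex. *)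
Lemma spanning_tree_degree2_is_path T :
    connected_graph G -> spanning_tree T ->
    (forall v, #|[set i in T | v \in ends i]| <= 2) ->
  is_path T.
Proof.
move=> [/card_gt0P[x0 _] conG] [acT maxT] deg.
have [x [p [U pT maxx maxl]]] := exists_maximal_path T x0.
have edgesT := maximal_path_edges acT deg U pT maxx maxl.
have closedT u w : edge_rel T u w -> (u \in x :: p) = (w \in x :: p).
  suff sub u' w' : edge_rel T u' w' -> u' \in x :: p -> w' \in x :: p.
    by move=> uw; apply/idP/idP; apply: sub; rewrite // edge_rel_sym.
  move=> uw up; have /mem_pairmapP[k kp /setP/(_ w')] := edgesT _ _ up uw.
  rewrite !inE eqxx orbT => /esym/orP[]/eqP ->.
    by apply: (mem_nth x (s := x :: p)); rewrite ltnS ltnW.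
  exact: (mem_nth x (n := k.+1) (s := x :: p)).
(* An edge of G leaving the path could be added to T without creating a cycle,
   contradicting the maximality of T. *)
have spans v : v \in x :: p.
  have /connectP[q xq ->] := conG x v.
  rewrite -(path_invariant (W := fun u => u \in x :: p) _ xq) ?mem_head //.
  move=> a b ab; apply/eqP/negPn/negP => Wab.
  pose i : edge G := Sub [set a; b] ab.
  have acU := bridge_acyclic closedT Wab (erefl : ends i = _) acT.
  case/eqP: Wab; apply: closedT.
  by rewrite -(maxT _ acU (finset.subsetU1 _ _)) edge_relU1 eqxx.
exists x, p; split=> //; apply/setP => A; rewrite inE.
apply/idP/idP => [/imsetP[i iT ->]|/mem_pairmapP[k kp ->]]; last first.
  exact: (pathP x pT).
have /eqP/cards2P[a [b [_ Eab]]] := card_ends i.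
by rewrite Eab; apply: edgesT; rewrite // /edge_rel -Eab imset_f.
Qed.

(** [M] takes the edges at even positions; two path edges sharing a vertex have consecutive
    positions, hence opposite parities. *)
Lemma is_path_split_matchings T :
  is_path T -> exists2 M : {set edge G}, M \subset T & matching M /\ matching (T :\: M).
Proof.
case=> x [p [U ET]]; set s := x :: p.
pose pair k : {set vertex G} := [set nth x s k; nth x s k.+1].
pose even_edge i := [exists k : 'I_(size p), ~~ odd k && (ends i == pair k)].
have pathT i : i \in T -> exists2 k, k < size p & ends i = pair k.
  move=> iT; apply/mem_pairmapP.
  by have := imset_f (@ends G) iT; rewrite ET inE.
have matchingP M (c : bool) :
    (forall i, i \in M -> exists k, [/\ k < size p, odd k = c & ends i = pair k]) ->
  matching M.
  move=> HM v; apply/card_le1_eqP => i j.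
  rewrite !inE => /andP[/HM[k [kp ok Ei]] vi] /andP[/HM[l [lp ol Ej]] vj].
  suff Ekl : k = l by apply: val_inj; rewrite -[val i]/(ends i) Ei Ekl -Ej.
  (* Two edges at [v] thus have positions differing by at most one, and equal parity makes them
     coincide. *)
  have idx m : m < size p -> v \in pair m -> index v s = m \/ index v s = m.+1.
    move=> mp; rewrite !inE => /orP[]/eqP ->; [left|right].
      by rewrite index_uniq //= ltnS ltnW.
    by rewrite index_uniq.
  rewrite Ei in vi; rewrite Ej in vj.
  by have := idx _ kp vi; have := idx _ lp vj; rewrite -ok in ol; lia.
exists [set i in T | even_edge i].
  by apply/fintype.subsetP => i; rewrite inE => /andP[].
split; [apply: (matchingP _ false)|apply: (matchingP _ true)] => i; rewrite !inE.
  case/andP=> _ /existsP[k /andP[/negPf ok /eqP Ei]]; exists k; split=> //.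
rewrite negb_and => /andP[/orP[/negPf -> //|nev] iT].
have [k kp Ei] := pathT i iT; exists k; split=> //; apply/negPn/negP => ok.
by case/existsP: nev; exists (Ordinal kp); rewrite ok Ei eqxx.
Qed.

End Combinatorics.

Local Open Scope classical_set_scope.
Local Open Scope ring_scope.

(** * Convex hulls *)

Section Hulls.
Variables (R : realType) (V : lmodType R).
Implicit Types (A C : set V).

Lemma sub_conv A : A `<=` Defs.conv A.
Proof. by move=> x Ax C [_]; exact. Qed.

Lemma convP A x y (t : R) : 0 < t < 1 ->
  Defs.conv A x -> Defs.conv A y -> Defs.conv A (t *: x + (1 - t) *: y).
Proof.
move=> /andP[t0 t1] Ax Ay C [cC AC].
have := cC x y (Itv01 (ltW t0) (ltW t1)) _ _.
by rewrite !in_setE; apply; [apply: Ax|apply: Ay].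
Qed.

(** Induction principle for the hull. The weights are strict because [conv_mean_extreme] would fail
    at [t = 0]. *)
Lemma conv_min A C :
    (forall x y (t : R), 0 < t < 1 -> C x -> C y -> C (t *: x + (1 - t) *: y)) ->
  A `<=` C -> Defs.conv A `<=` C.
Proof.
move=> cC AC; apply: smallest_sub => //; apply/convex_setW => x y.
move=> /set_mem Cx /set_mem Cy t t0 t1; apply/mem_set.
by apply: cC => //; rewrite t0 t1.
Qed.
End Hulls.

(** * Integer points and degree bounds of the polytopes *)

Section Polytopes.
Variables (R : realType) (G : sgraph).
Implicit Types (F : set {set edge G}) (T : {set edge G}) (x : {ffun edge G -> R^o}).

Lemma indicatorE T i : indicator R T i = (i \in T)%:R.
Proof.
rewrite /indicator sum_ffunE big_mkcond /=.
rewrite (bigD1 i) //= ffunE eqxx big1 => [|j ji]; first by case: ifP; rewrite addr0.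
by rewrite ffunE eq_sym (negPf ji); case: ifP.
Qed.

(** The mean is an integer in [0,1], hence 0 or 1; since [t] is positive, it can reach such a bound
    only if [a] does. *)
Lemma conv_mean_extreme (a b t : R) : 0 < t < 1 -> 0 <= a <= 1 -> 0 <= b <= 1 ->
  t * a + (1 - t) * b \is a Num.int -> t * a + (1 - t) * b = a.
Proof.
move=> /andP[t0 t1] /andP[a0 a1] /andP[b0 b1] /intrP[m Em]; rewrite Em.
have m0 : 0 <= m by rewrite -(ler0z R) -Em; nra.
have m1 : m <= 1 by rewrite -(ler_int R) -Em; nra.
have [E|E] : m = 0 \/ m = 1 by lia.
  by rewrite E in Em *; nra.
by rewrite E in Em *; nra.
Qed.

(* A point of the 0/1 cube with integral coordinates is extreme in the cube. *)
Lemma integer_points_conv_indicator F x :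
    Defs.conv [set indicator R T | T in F] x -> integer_points R G x ->
  [set indicator R T | T in F] x.
Proof.
move=> Fx xZ.
(* The implication passes from [a] to a mean of [a] and [b]: if the mean is [x], then [a = x]
   coordinatewise. The cube bounds in [C] make this argument available. *)
pose C (y : {ffun edge G -> R^o}) :=
  (forall i, (0 : R) <= y i <= 1) /\ (y = x -> [set indicator R T | T in F] x).
suff /conv_min H : [set indicator R T | T in F] `<=` C.
  apply: (H _ _ Fx).2 => // a b t t01 [a01 Fa] [b01 Fb]; split=> [i|E].
    rewrite !ffunE; move: (a01 i) (b01 i) => /andP[? ?] /andP[? ?].
    by case/andP: t01 => ? ?; rewrite /GRing.scale /=; nra.
  apply: Fa; apply/ffunP => i; move: (xZ i); rewrite -E !ffunE => Zi.
  by rewrite (conv_mean_extreme t01 (a01 i) (b01 i) Zi).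
move=> _ [T FT <-]; split=> [i|<-]; last by exists T.
by rewrite indicatorE; case: (_ \in _); rewrite ?lexx ?ler01.
Qed.

(** The bound is linear, so it passes from the generators to the hull; at [indicator R M] the sum
    counts the edges of [M] at [v]. *)
Lemma matching_polytope_degree x v : matching_polytope R G x ->
  \sum_(i | v \in ends i) (x i : R) <= 1.
Proof.
move: x; apply: conv_min => [a b t /andP[t0 t1] a1 b1|_ [M HM <-]] /=.
  set sa := \sum_(i | _) a i in a1; set sb := \sum_(i | _) b i in b1.
  suff -> : \sum_(i | v \in ends i) ((t *: a + (1 - t) *: b) i : R)
      = t * sa + (1 - t) * sb by nra.
  by rewrite !mulr_sumr -big_split; apply: eq_bigr => i _; rewrite !ffunE.
under eq_bigr do rewrite indicatorE.
rewrite -natr_sum -big_mkcondr sum1_card lern1; apply: leq_trans (HM v).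
by apply: eq_leq; apply: eq_card => i; rewrite !inE andbC.
Qed.

End Polytopes.

Theorem proposition4p6 (R : realType) (G : sgraph) (HG : connected_graph G) :
  Theta R G `&` integer_points R G
  = [set indicator R T | T in [set T | hamiltonian_path T]].
Proof.
apply/seteqP; split=> [x [[Px [y My /= xy]] Zx]|_ [T [sT pT] <-]].
  have [T sT xT] := integer_points_conv_indicator Px Zx.
  exists T => //; split=> //; apply: spanning_tree_degree2_is_path => // v.
  (* Here [indicator R T] is twice [y], so doubling the bound for [y] leaves at most two edges of
     [T] at [v]. *)
  have := matching_polytope_degree v My.
  rewrite -(ler_pM2l (ltr0n R 2)) mulr1 mulr_sumr.
  have E i : 2 * (y i : R) = (i \in T)%:R by rewrite -indicatorE xT -xy ffunE.
  under eq_bigr do rewrite E.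
  rewrite -natr_sum -big_mkcondr sum1_card ler_nat; apply: leq_trans.
  by apply: eq_leq; apply: eq_card => i; rewrite !inE andbC.
split; last by move=> i; rewrite indicatorE natr_int.
split; first by apply: sub_conv; exists T.
have [M MT [M1 M2]] := is_path_split_matchings pT.
have half01 : 0 < (2^-1 : R) < 1 by lra.
exists (2^-1 *: indicator R M + (1 - 2^-1) *: indicator R (T :\: M)).
  by apply: convP => //; apply: sub_conv; [exists M|exists (T :\: M)].
apply/ffunP => i; rewrite !ffunE !indicatorE inE.
have := fintype.subsetP MT i.
by case: (i \in M) => [/(_ isT) ->|_]; case: (i \in T); rewrite /GRing.scale /=; lra.
Qed.
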